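(* Let $G$ be a finite abelian group and $F\colon G\to\mathbb{R}$ a function. For an arbitrary non-empty subset $P\subset G$, we have $$\mathbb{E}_{\sigma\in G}[I_{P+\sigma}(F)]=I(F).$$
   Context: $I(F)=|G|^{-1}\sum_{g\in G}F(g)$. For $\sigma\in G$, $P+\sigma=\{g+\sigma\mid g\in P\}$ and $I_{P+\sigma}(F)=|P|^{-1}\sum_{g\in P}F(g+\sigma)$. $\mathbb{E}_{\sigma\in G}$ is the expectation with respect to $\sigma$ uniformly distributed on $G$: $\mathbb{E}_{\sigma\in G}[I_{P+\sigma}(F)]=|G|^{-1}\sum_{\sigma\in G}I_{P+\sigma}(F)$. *)

(* Defs.v *)
From HB Require Import structures.
From mathcomp Require Import all_boot all_order all_algebra.
From mathcomp Require Import reals.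

Set Implicit Arguments.
Unset Strict Implicit.
Unset Printing Implicit Defensive.

Import GRing.Theory.
Local Open Scope ring_scope.

Section Averages.
Variables (R : realType) (G : finZmodType).

Definition group_mean (F : G -> R) : R := #|G|%:R^-1 * \sum_(g : G) F g.

Definition translate (P : {set G}) (sigma : G) : {set G} :=
  [set g + sigma | g in P].

Definition shifted_mean (P : {set G}) (sigma : G) (F : G -> R) : R :=
  #|P|%:R^-1 * \sum_(g in P) F (g + sigma).

(* [shifted_mean P sigma] depends only on the point set P + sigma: it is the
   equal-weight average over that set. *)
Lemma shifted_meanE (P : {set G}) (sigma : G) (F : G -> R) :
  shifted_mean P sigma F =
  #|translate P sigma|%:R^-1 * \sum_(h in translate P sigma) F h.
Proof.
have inj : injective (fun g : G => g + sigma) by exact: addIr.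
rewrite /shifted_mean /translate card_imset // big_imset //=.
by move=> x y _ _; exact: inj.
Qed.

(* Expectation of X(sigma) for sigma uniformly distributed on G. *)
Definition uniform_expectation (X : G -> R) : R :=
  #|G|%:R^-1 * \sum_(sigma : G) X sigma.

End Averages.

(* Main.v *)
(* For each fixed g in P the map sigma |-> g + sigma permutes G, so after
   exchanging the two sums every inner sum equals the sum of F over G; the
   |P| equal terms cancel the normalisation of the shifted mean. *)
Require Import Defs.
From HB Require Import structures.
From mathcomp Require Import all_boot all_order all_algebra.
From mathcomp Require Import reals.

Import GRing.Theory Num.Theory.

Theorem proposition2 (R : realType) (G : finZmodType) (F : G -> R)
    (P : {set G}) (hP : P != set0) :
  uniform_expectation (fun sigma : G => shifted_mean P sigma F) = group_mean F.
Proof.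
rewrite /uniform_expectation /shifted_mean /group_mean -mulr_sumr exchange_big /=.
rewrite (eq_bigr (fun=> (\sum_h F h)%R)); last first.
  (* The substitution [h = g + sigma] is made on the right; cancellation gives injectivity, which on
     the finite [G] already makes it a bijection. *)
  by move=> g _; rewrite [RHS](reindex_inj (addrI g)).
(* The summand is given explicitly because [#|G|%:R] is itself a multiple [1 *+ #|G|] and would also
   match. *)
rewrite sumr_const -(mulr_natl (\sum_h F h)%R) mulKf //.
(* Cancelling needs [#|P|%:R != 0]: in characteristic zero this is just nonemptiness of [P]. *)
by rewrite pnatr_eq0 -lt0n card_gt0.
Qed.
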